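(* Let $n\ge 1$ and let $\mathfrak{A}_n$ be the group of all automorphisms $f$ of the real Lie algebra $\mathfrak{gl}_n(\mathbb{C})$ such that (i) $f(A^* )=f(A)^*$ for every $A\in\mathfrak{gl}_n(\mathbb{C})$, and (ii) $f(ABA)=f(A)f(B)f(A)$ for every $A,B\in\mathfrak{gl}_n(\mathbb{C})$. Then, for every $f\in\mathfrak{A}_n$, the set $Fix(f):=\{M\in\mathfrak{gl}_n(\mathbb{C}) : f(M)=M\}$ is an SVD-closed real Lie subalgebra of $\mathfrak{gl}_n(\mathbb{C})$.
   Context: $\mathfrak{gl}_n(\mathbb{C})$ is the set of $n\times n$ complex matrices, regarded as a real Lie algebra; $A^*$ is the conjugate transpose of $A$. A non-empty family $A_1,\dots,A_p$ of non-zero matrices of $\mathfrak{gl}_n(\mathbb{C})$ is an SVD-system if $A_h^*A_j=A_hA_j^*=0$ for every $h\neq j$ and $A_jA_j^*A_j=A_j$ for every $j$. Every $M\in\mathfrak{gl}_n(\mathbb{C})\setminus\{0\}$ has a unique SVD-decomposition $M=\sum_{j=1}^p\sigma_jA_j$, where $A_1,\dots,A_p$ is an SVD-system and $\sigma_1>\sigma_2>\dots>\sigma_p>0$ are real numbers (the distinct non-zero singular values of $M$); the matrices $A_j$ are the SVD-components of $M$. A real Lie subalgebra $\mathfrak{g}$ of $\mathfrak{gl}_n(\mathbb{C})$ is SVD-closed if all SVD-components of every matrix of $\mathfrak{g}\setminus\{0\}$ belong to $\mathfrak{g}$. *)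

(* Defs.v *)
From mathcomp Require Import all_boot all_order all_algebra.
From mathcomp Require Import classical_sets reals complex.

Set Implicit Arguments.
Unset Strict Implicit.
Unset Printing Implicit Defensive.

Import GRing.Theory Num.Theory.

Local Open Scope classical_set_scope.
Local Open Scope ring_scope.
Local Open Scope complex_scope.
Local Open Scope sesquilinear_scope.

(* Matrices over [R[i]] carry only the structure of a complex vector space in
   the library, so the real one is expressed with scalars [a%:C], [a : R]. *)
Notation gl R n := 'M[R[i]]_n.

Section Defs.
Context {R : realType} {n : nat}.

Implicit Types (M A B X : gl R n) (g : set (gl R n)) (f : gl R n -> gl R n).

Definition lie_bracket A B : gl R n := A *m B - B *m A.

Record is_SVD_system (p : nat) (A : 'I_p -> gl R n) : Prop := {
  SVD_system_nonempty : (0 < p)%N ;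
  SVD_system_neq0 : forall j, A j != 0 ;
  SVD_system_orth : forall h j, h != j ->
    (A h)^t* *m A j = 0 /\ A h *m (A j)^t* = 0 ;
  SVD_system_partial_isometry : forall j, A j *m (A j)^t* *m A j = A j
}.

Record is_SVD_decomposition M (p : nat) (s : 'I_p -> R) (A : 'I_p -> gl R n) :
    Prop := {
  SVD_dec_system : is_SVD_system A ;
  SVD_dec_pos : forall j, 0 < s j ;
  SVD_dec_decreasing : forall h j : 'I_p, (h < j)%N -> s j < s h ;
  SVD_dec_sum : M = \sum_(j < p) (s j)%:C *: A j
}.

Definition SVD_component M X : Prop :=
  exists (p : nat) (s : 'I_p -> R) (A : 'I_p -> gl R n),
    is_SVD_decomposition M s A /\ exists j, X = A j.

Record is_real_lie_subalgebra g : Prop := {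
  lie_subalgebra0 : g 0 ;
  lie_subalgebraD : forall A B, g A -> g B -> g (A + B) ;
  lie_subalgebraZ : forall (a : R) A, g A -> g (a%:C *: A) ;
  lie_subalgebra_bracket : forall A B, g A -> g B -> g (lie_bracket A B)
}.

Definition SVD_closed g : Prop :=
  forall M, g M -> M != 0 -> forall X, SVD_component M X -> g X.

Record is_real_lie_automorphism f : Prop := {
  lie_automorphism_bij : bijective f ;
  lie_automorphismD : forall A B, f (A + B) = f A + f B ;
  lie_automorphismZ : forall (a : R) A, f (a%:C *: A) = a%:C *: f A ;
  lie_automorphism_bracket : forall A B,
    f (lie_bracket A B) = lie_bracket (f A) (f B)
}.

(* The carrier of the group [\mathfrak{A}_n]. *)
Definition frakA : set (gl R n -> gl R n) :=
  [set f | [/\ is_real_lie_automorphism f,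
               forall A, f (A^t*) = (f A)^t* &
               forall A B, f (A *m B *m A) = f A *m f B *m f A]].

Definition Fix f : set (gl R n) := [set M | f M = M].

End Defs.

Arguments frakA : clear implicits.

(* Main.v *)
(** Writing [M = sum_j s_j A_j], every real combination
    [M_P = sum_j s_j P(s_j^2) A_j], with [P] a real polynomial, is fixed by [f]:
    the orthogonality relations give [M_(XP) = M (M_P)^* M], so this follows by
    induction on [P]. As the [s_j^2] are distinct, choosing [P] to vanish at all
    of them but one isolates a non-zero real multiple of [A_j]. *)
Require Import Defs.
From mathcomp Require Import all_boot all_order all_algebra.
From mathcomp Require Import classical_sets reals complex.

Set Implicit Arguments.
Unset Strict Implicit.
Unset Printing Implicit Defensive.

Import Order.TTheory GRing.Theory Num.Theory.

Local Open Scope ring_scope.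
Local Open Scope complex_scope.
Local Open Scope sesquilinear_scope.

Lemma Fix_real_lie_subalgebra (R : realType) (n : nat) (f : gl R n -> gl R n) :
  is_real_lie_automorphism f -> is_real_lie_subalgebra (Fix f).
Proof.
case=> _ fD fZ fB; split; rewrite /Fix /=.
(* Homogeneity at the scalar [0] gives [f 0 = 0]. *)
- by have := fZ 0 0; rewrite !scale0r.
- by move=> A B fA fB'; rewrite fD fA fB'.
- by move=> a A fA; rewrite fZ fA.
- by move=> A B fA fB'; rewrite fB fA fB'.
Qed.

Section SVDSystem.
Context {R : realType} {n p : nat}.
Implicit Types (A : 'I_p -> gl R n) (c d e s : 'I_p -> R).

Definition real_comb A c : gl R n := \sum_(j < p) (c j)%:C *: A j.

Lemma real_comb_adj A c :
  (real_comb A c)^t* = \sum_(j < p) (c j)%:C *: (A j)^t*.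
Proof.
rewrite /real_comb raddf_sum /= raddf_sum; apply: eq_bigr => j _ /=.
by rewrite linearZ /= map_mxZ; congr (_ *: _); exact: conjc_real.
Qed.

(** Orthogonality kills all mixed terms, and [A_j A_j^* A_j = A_j] collapses the diagonal ones, so
    the triple product acts coefficientwise. The coefficients being real, the adjoint does not alter
    them. *)
Lemma real_comb_triple A c d e : is_SVD_system A ->
  real_comb A c *m (real_comb A d)^t* *m real_comb A e =
  real_comb A (fun j => c j * d j * e j).
Proof.
case=> _ _ orthA isoA.
(* The two orthogonality relations serve in turn: [A_j A_k^* = 0] here, then [A_j^* A_k = 0] for the
   third factor. *)
have -> : real_comb A c *m (real_comb A d)^t* =
    \sum_(j < p) (c j * d j)%:C *: (A j *m (A j)^t*).
  rewrite real_comb_adj mulmx_suml; apply: eq_bigr => j _.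
  rewrite mulmx_sumr (bigD1 j) //= big1 ?addr0 => [|k kj].
    by rewrite -scalemxAl -scalemxAr scalerA rmorphM.
  have /orthA[_ Ajk] : j != k by rewrite eq_sym.
  by rewrite -scalemxAl -scalemxAr Ajk !scaler0.
rewrite mulmx_suml; apply: eq_bigr => j _.
rewrite mulmx_sumr (bigD1 j) //= big1 ?addr0 => [|k kj].
  by rewrite -scalemxAl -scalemxAr scalerA isoA -rmorphM.
have /orthA[Ajk _] : j != k by rewrite eq_sym.
by rewrite -scalemxAl -scalemxAr -mulmxA Ajk mulmx0 !scaler0.
Qed.

(** [f] is only known to preserve products of the form [ABA], which is why the coefficients are odd
    polynomials in [s j]. *)
Lemma frakA_fix_odd_poly (f : gl R n -> gl R n) A s (P : {poly R}) :
  frakA R n f -> is_SVD_system A -> Fix f (real_comb A s) ->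
  Fix f (real_comb A (fun j => s j * P.[s j ^+ 2])).
Proof.
move=> [fL fstar ftriple] sysA fM.
have [fix0 fixD fixZ _] := Fix_real_lie_subalgebra fL.
elim/poly_ind: P => [|P c fP].
  rewrite (_ : real_comb _ _ = 0) // /real_comb big1 // => j _.
  by rewrite horner0 mulr0 scale0r.
(* Horner step for [P * 'X + c%:P]: the triple product, of the form [ABA] with [B] an adjoint,
   raises the degree, and the last summand accounts for the constant [c]. *)
rewrite (_ : real_comb _ _ =
    real_comb A s *m (real_comb A (fun j => s j * P.[s j ^+ 2]))^t*
      *m real_comb A s + c%:C *: real_comb A s).
  by apply: fixD (fixZ _ _ fM); rewrite /Fix /= ftriple fstar fM fP.
rewrite real_comb_triple // /real_comb scaler_sumr -big_split.
apply: eq_bigr => j _ /=.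
rewrite scalerA -scalerDl -rmorphM -rmorphD; congr (_%:C *: _).
rewrite !hornerE mulrDr [c * _]mulrC expr2 !mulrA; congr (_ + _).
by rewrite -!mulrA; congr (_ * _); rewrite mulrCA.
Qed.

Lemma frakA_fix_SVD_component (f : gl R n -> gl R n) (M : gl R n) s A j :
  frakA R n f -> is_SVD_decomposition M s A -> Fix f M -> Fix f (A j).
Proof.
move=> fA [sysA s_gt0 s_decr ->] fM.
pose P : {poly R} := \prod_(h < p | h != j) ('X - (s h ^+ 2)%:P).
have root_P h : h != j -> P.[s h ^+ 2] = 0.
  by move=> hj; rewrite horner_prod (bigD1 h) //= hornerXsubC subrr mul0r.
have s_inj h : h != j -> s h != s j.
  rewrite -val_eqE neq_ltn => /orP[] /s_decr; first by move/gt_eqF->.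
  by move/lt_eqF->.
(* Squaring is injective on positive reals, so distinct [s h] have distinct squares and no factor of
   [P] vanishes at [s j ^+ 2]. *)
have Pj_neq0 : P.[s j ^+ 2] != 0.
  rewrite horner_prod; apply/prodf_neq0 => h hj.
  rewrite hornerXsubC subr_eq0 eqrXn2 ?ltW //.
  by rewrite eq_sym s_inj.
(* The only surviving coefficient; it is real, so dividing by it stays within [Fix f]. *)
set a := s j * P.[s j ^+ 2].
have a_neq0 : a != 0 by rewrite mulf_neq0 // gt_eqF.
have [_ _ fixZ _] : is_real_lie_subalgebra (Fix f).
  by case: fA => fL _ _; exact: Fix_real_lie_subalgebra.
have <- : a^-1%:C *: real_comb A (fun k => s k * P.[s k ^+ 2]) = A j.
  rewrite /real_comb (bigD1 j) //= big1 ?addr0 => [|k kj].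
    by rewrite scalerA -rmorphM /= -/a mulVf // scale1r.
  by rewrite root_P // mulr0 scale0r.
exact/fixZ/frakA_fix_odd_poly.
Qed.

End SVDSystem.

Theorem proposition3p5 (R : realType) (n : nat) (n_ge1 : (1 <= n)%N)
    (f : gl R n -> gl R n) (f_frakA : frakA R n f) :
  is_real_lie_subalgebra (Fix f) /\ SVD_closed (Fix f).
Proof.
split; first by case: f_frakA => fL _ _; exact: Fix_real_lie_subalgebra.
move=> M fM _ X [p [s [A [decM [j ->]]]]].
exact: frakA_fix_SVD_component decM fM.
Qed.
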